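(* Let $G=(V,E)$ be a graph. Then we have $$\nu(G)\le\min\left\{\frac{2|E|}{|V|},\ \frac{4b_1(G)}{|V|},\ d_{\max}-1\right\},$$ where $d_{\max}$ is the maximal vertex degree of $G$.
   Context: All graphs $G=(V,E)$ are finite and simple; $x\sim y$ denotes adjacency. $E^{or}(G)$ is the set of ordered pairs $(x,y)$ with $x\sim y$. A magnetic potential is a map $\sigma:E^{or}(G)\to S^1=\{z\in\mathbb{C}:|z|=1\}$ with $\sigma(y,x)=\sigma(x,y)^{-1}$. The magnetic Laplacian on functions $f:V\to\mathbb{C}$ is $\Delta^\sigma f(x)=\sum_{y\sim x}(f(x)-\sigma(x,y)f(y))$, and $\lambda_1^\sigma(G)$ is its smallest eigenvalue. The magneto-spectral height is $\nu(G)=\sup_\sigma\lambda_1^\sigma(G)$, over all magnetic potentials. The first Betti number is $b_1(G)=|E|-|V|+k$, where $k$ is the number of connected components of $G$.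
   Formalization: The graph is assumed to have at least one edge; for an edgeless nonempty graph the claim fails, since ν(G)=0 while d_max−1=−1, and for the empty graph the terms are undefined. *)

(* Defs.v *)
From HB Require Import structures.
From mathcomp Require Import all_boot all_order all_algebra complex.
From mathcomp Require Import boolp classical_sets reals.

Set Implicit Arguments.
Unset Strict Implicit.
Unset Printing Implicit Defensive.

Import Order.TTheory GRing.Theory Num.Theory.

Local Open Scope ring_scope.
Local Open Scope complex_scope.

(* A finite simple graph is a finite type [V] of vertices with an adjacency
   relation [e : rel V] that is symmetric and irreflexive; these two properties
   are hypotheses of the results rather than fields of a structure. *)

Definition edge_set (V : finType) (e : rel V) : {set {set V}} :=
  [set [set p.1; p.2] | p : V * V & e p.1 p.2].

Definition degree (V : finType) (e : rel V) (x : V) : nat :=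
  #|[set y | e x y]|.

Definition max_degree (V : finType) (e : rel V) : nat :=
  (\max_(x : V) degree e x)%N.

(* Integer-valued, so that the subtraction is not truncated. *)
Definition betti1 (V : finType) (e : rel V) : int :=
  #|edge_set e|%:Z - #|V|%:Z + (n_comp e V)%:Z.

(* A potential is only constrained on pairs of adjacent vertices; its values
   elsewhere are irrelevant, since [magnetic_laplacian] never uses them. *)
Definition magnetic_potential (R : realType) (V : finType) (e : rel V) :
    set (V -> V -> R[i]) :=
  [set s | forall x y, e x y -> `|s x y| = 1 /\ s y x = (s x y)^-1].

Definition magnetic_laplacian (R : realType) (V : finType) (e : rel V)
    (s : V -> V -> R[i]) (f : {ffun V -> R[i]^o}) : {ffun V -> R[i]^o} :=
  [ffun x => \sum_(y | e x y) (f x - s x y * f y)].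

Lemma magnetic_laplacian_is_linear (R : realType) (V : finType) (e : rel V)
  (s : V -> V -> R[i]) : linear (magnetic_laplacian e s).
Proof.
move=> a f g; apply/ffunP => x; rewrite !ffunE scaler_sumr -big_split /=.
apply: eq_bigr => y _; rewrite !ffunE /GRing.scale /=.
by rewrite mulrDr mulrBr mulrCA opprD addrACA.
Qed.

HB.instance Definition _ (R : realType) (V : finType) (e : rel V)
    (s : V -> V -> R[i]) :=
  GRing.isLinear.Build _ _ _ _ (magnetic_laplacian e s)
    (magnetic_laplacian_is_linear e s).

(* The order on [R[i]] is the partial one in which [a <= b] means that [b - a]
   is a nonnegative real, so the second conjunct also says that every complex
   eigenvalue is real. *)
Definition smallest_eigenvalue (R : realType) (vT : vectType R[i])
    (phi : 'End(vT)) (t : R) : Prop :=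
  passmx.leigenvalue phi t%:C /\ forall z : R[i], passmx.leigenvalue phi z -> t%:C <= z.

(* The default value 0 is used only if there is no smallest eigenvalue, which
   does not happen for a potential on a nonempty graph: the magnetic Laplacian
   is then a Hermitian operator on a nonzero space. *)
Definition lambda1 (R : realType) (V : finType) (e : rel V)
    (s : V -> V -> R[i]) : R :=
  xget 0 [set t | smallest_eigenvalue (linfun (magnetic_laplacian e s)) t]%classic.

(* The set is nonempty (constant potential 1) and bounded above (by the average
   degree), so [sup] is the genuine supremum on a nonempty graph. *)
Definition magneto_spectral_height (R : realType) (V : finType) (e : rel V) : R :=
  sup [set lambda1 e s | s in @magnetic_potential R V e]%classic.

(* Main.v *)
Require Import Defs.
From mathcomp Require Import all_boot all_order all_algebra complex.
From mathcomp Require Import boolp classical_sets reals.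
From mathcomp Require Import zify.

Local Open Scope ring_scope.

(** The magnetic Laplacian is self-adjoint for the Hermitian product [hdot], so
    the spectral theorem makes its smallest eigenvalue a lower bound of every
    Rayleigh quotient ([lambda1_rayleigh]). Each of the three upper bounds on
    [lambda1] comes from one family of test functions, for an arbitrary
    potential; the supremum then inherits them.

    - The Rayleigh quotient of the point mass at [x] is the degree of [x]
      ([lambda1_le_degree]). Averaging over the vertices gives the mean degree
      2|E| / |V|.

    - On an edge [x], [y], the function supported on its two ends with values
      [1] and [s y x] is parallel along the edge, so the edge does not contribute
      to its energy and the quotient is [(deg x - 1 + deg y - 1) / 2]
      ([lambda1_le_edge]). This is at most [d_max - 1].

    - A unimodular function has squared norm |V|, and an edge contributes to its
      energy nothing if the function is parallel along it, and at most 4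
      otherwise ([lambda1_le_frustrated]). Transporting the value 1 from the
      roots along a spanning forest produces a unimodular function which is
      parallel along all the edges of the forest. There are |V| - k of these, so
      at most [b_1] edges contribute ([few_frustrated]), whence 4 b_1 / |V|.

    Edges are counted through ordered pairs of adjacent vertices, which are
    twice as many ([card_edge_set]): the Laplacian is a sum over such pairs. *)

Set Implicit Arguments.
Unset Strict Implicit.
Unset Printing Implicit Defensive.

Import Order.TTheory GRing.Theory Num.Theory.
Local Open Scope complex_scope.
Local Open Scope sesquilinear_scope.
(* Reopened so that [^*] is the conjugation of a [numClosedFieldType]. *)
Local Open Scope ring_scope.

(** * Rayleigh's principle for self-adjoint operators *)

(** In an orthonormal basis of eigenvectors the Hermitian form is a diagonal one
    with real coefficients, and its least coefficient bounds it from below. *)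
Lemma hermitian_rayleigh_min (R : rcfType) n (A : 'M[R[i]]_n) :
  (0 < n)%N -> A \is hermsymmx ->
  exists t : R, eigenvalue A t%:C /\
    forall v : 'rV_n, t%:C * (v *m v ^t* ) 0 0 <= (v *m A *m v ^t* ) 0 0.
Proof.
move=> n_gt0 Aherm.
have /orthomx_spectralP := hermitian_normalmx Aherm.
have Dreal := hermitian_spectral_diag_real Aherm.
have Punitary := spectral_unitarymx A.
set P := spectralmx A in Punitary *; set D := spectral_diag A in Dreal *.
rewrite invmx_unitary // => defA.
have DE j : (complex.Re (D 0 j))%:C = D 0 j.
  by rewrite RRe_real //; apply: (mxOverP Dreal).
pose i0 := Ordinal n_gt0.
have [i _ imin] :=
  @arg_minP _ R _ i0 xpredT (fun j => complex.Re (D 0 j)) isT.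
exists (complex.Re (D 0 i)); rewrite DE; split.
  apply/eigenvalueP; exists (row i P).
    rewrite {1}defA rowE !mulmxA mulmxtVK // -(rowE i (diag_mx D)).
    by rewrite row_diag_mx -scalemxAl.
  apply/eqP => rowP0; have /unitarymxP/matrixP/(_ i i) := Punitary.
  rewrite !mxE eqxx => /eqP; rewrite big1 1?eq_sym ?oner_eq0 // => j _.
  by move/rowP/(_ j): rowP0; rewrite !mxE => ->; rewrite mul0r.
(* The coordinates of [v] in the basis of eigenvectors. *)
move=> v; pose w := v *m P ^t*.
have wtE : w ^t* = P *m v ^t* by rewrite trmx_mul map_mxM trmxCK.
have -> : v *m v ^t* = w *m w ^t* by rewrite wtE mulmxA mulmxKtV.
have -> : v *m A *m v ^t* = w *m diag_mx D *m w ^t*.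
  by rewrite wtE {1}defA !mulmxA.
rewrite mul_mx_diag; move: w {wtE} => w; rewrite !mxE mulr_sumr.
apply: ler_sum => j _; rewrite !mxE mulrAC [leRHS]mulrC.
rewrite ler_wpM2r -?normCK ?exprn_ge0 //.
by rewrite -DE -[D 0 j]DE lecR imin.
Qed.

Lemma leigenvalueP (F : fieldType) (vT : vectType F) (phi : 'End(vT)) (a : F) :
  reflect (exists2 v, v != 0 & phi v = a *: v) (passmx.leigenvalue phi a).
Proof.
rewrite /passmx.leigenvalue /passmx.leigenspace.
have memE v : (v \in lker (phi - a *: \1%VF)) = (phi v == a *: v).
  by rewrite memv_ker !lfun_simp subr_eq0.
apply: (iffP idP) => [nz|[v v_neq0 phi_v]].
  exists (vpick (lker (phi - a *: \1%VF))); first by rewrite vpick0.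
  by apply/eqP; rewrite -memE memv_pick.
by apply: contra_neq v_neq0 => k0; apply/eqP; rewrite -memv0 -k0 memE phi_v.
Qed.

Section HermitianProduct.
Variables (R : rcfType) (V : finType).
Implicit Types f g : {ffun V -> R[i]^o}.

Definition hdot f g : R[i] := \sum_x f x * (g x : R[i])^*.

Definition point_mass (x : V) : {ffun V -> R[i]^o} := [ffun y => (y == x)%:R].

Lemma hdotE f : hdot f f = \sum_x `|f x : R[i]| ^+ 2.
Proof. by apply: eq_bigr => x _; rewrite normCK. Qed.

Lemma hdot_ge0 f : 0 <= hdot f f.
Proof. by rewrite hdotE sumr_ge0 // => x _; rewrite exprn_ge0. Qed.

Lemma hdot_gt0 f : f != 0 -> 0 < hdot f f.
Proof.
move=> f_neq0; rewrite lt0r hdot_ge0 andbT; apply: contra_neq f_neq0 => /eqP.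
rewrite hdotE psumr_eq0 => [/allP f0|x _]; last by rewrite exprn_ge0.
apply/ffunP => x; have := f0 x; rewrite mem_index_enum => /(_ isT).
by rewrite expf_eq0 /= normr_eq0 ffunE => /eqP.
Qed.

Lemma hdotZl a f g : hdot (a *: f) g = a * hdot f g.
Proof. by rewrite mulr_sumr; apply: eq_bigr => x _; rewrite ffunE -mulrA. Qed.

Lemma hdot_point f x : hdot f (point_mass x) = f x.
Proof.
rewrite /hdot (bigD1 x) //= ffunE eqxx rmorph1 mulr1 big1 ?addr0 // => y.
by move=> /negPf yx; rewrite ffunE yx rmorph0 mulr0.
Qed.

Lemma point_hdot f x : hdot (point_mass x) f = (f x : R[i])^*.
Proof.
rewrite /hdot (bigD1 x) //= ffunE eqxx mul1r big1 ?addr0 // => y.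
by move=> /negPf yx; rewrite ffunE yx mul0r.
Qed.

End HermitianProduct.

Section SelfAdjoint.
Variables (R : realType) (V : finType).
Variable phi : {linear {ffun V -> R[i]^o} -> {ffun V -> R[i]^o}}.

Let coords (f : {ffun V -> R[i]^o}) : 'rV[R[i]]_#|V| := \row_i f (enum_val i).
Let operator_mx : 'M[R[i]]_#|V| :=
  \matrix_(i, j) phi (point_mass R (enum_val i)) (enum_val j).

Let coords_phi f : coords (phi f) = coords f *m operator_mx.
Proof.
have {1}-> : f = \sum_x f x *: point_mass R x.
  apply/ffunP => y; rewrite sum_ffunE (bigD1 y) //= !ffunE eqxx.
  rewrite big1 => [|x /negPf xy]; first by rewrite addr0 [_ *: _]mulr1.
  by rewrite !ffunE eq_sym xy scaler0.
apply/rowP => j; rewrite linear_sum !mxE sum_ffunE.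
rewrite (reindex _ (onW_bij _ (@enum_val_bij V))) /=.
by apply: eq_bigr => i _; rewrite linearZ_LR !mxE !ffunE.
Qed.

Let coordsM f g : (coords f *m (coords g) ^t* ) 0 0 = hdot f g.
Proof.
rewrite mxE [RHS](reindex _ (onW_bij _ (@enum_val_bij V))) /=.
by apply: eq_bigr => i _; rewrite !mxE.
Qed.

Let coordsK (v : 'rV_#|V|) : coords [ffun x => v 0 (enum_rank x)] = v.
Proof. by apply/rowP => i; rewrite mxE ffunE enum_valK. Qed.

Lemma selfadjoint_rayleigh_min : (0 < #|V|)%N ->
  (forall f g, hdot (phi f) g = hdot f (phi g)) ->
  exists t : R, passmx.leigenvalue (linfun phi) t%:C /\
    forall f, t%:C * hdot f f <= hdot (phi f) f.
Proof.
move=> V_gt0 phi_sa.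
have herm : operator_mx \is hermsymmx.
  apply/is_hermitianmxP; rewrite expr0 scale1r; apply/matrixP => i j.
  by rewrite !mxE -[LHS]hdot_point phi_sa point_hdot.
have [t [/eigenvalueP[v v_eig v_neq0] t_min]] :=
  hermitian_rayleigh_min V_gt0 herm.
exists t; split=> [|f].
  apply/leigenvalueP; exists [ffun x => v 0 (enum_rank x)].
    apply: contra_neq v_neq0 => f0; rewrite -[v]coordsK f0.
    by apply/rowP => i; rewrite !mxE ffunE.
  rewrite lfunE /=.
  have := coords_phi [ffun x => v 0 (enum_rank x)]; rewrite coordsK v_eig.
  move=> phiE; apply/ffunP => x; move/rowP/(_ (enum_rank x)): phiE.
  by rewrite !mxE enum_rankK !ffunE.
by rewrite -!coordsM coords_phi t_min.
Qed.

(** The eigenvalue of the previous lemma is a smallest one, since an eigenvector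
    has its eigenvalue as Rayleigh quotient. Hence [xget] does not fall back on
    its default value, and any value it returns is at most that eigenvalue. *)
Lemma smallest_eigenvalue_rayleigh : (0 < #|V|)%N ->
  (forall f g, hdot (phi f) g = hdot f (phi g)) ->
  forall f,
    (xget 0 [set t | smallest_eigenvalue (linfun phi) t]%classic)%:C * hdot f f
      <= hdot (phi f) f.
Proof.
move=> V_gt0 phi_sa f; set u := xget _ _.
have [t [t_eig t_min]] := selfadjoint_rayleigh_min V_gt0 phi_sa.
have : smallest_eigenvalue (linfun phi) u.
  apply: (@xgetPex _ 0 [set t | smallest_eigenvalue (linfun phi) t]%classic).
  exists t; split=> // z /leigenvalueP[g g_neq0]; rewrite lfunE /= => phi_g.
  by have := t_min g; rewrite phi_g hdotZl ler_pM2r // hdot_gt0.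
case=> _ /(_ _ t_eig) u_le; apply: le_trans (t_min f).
by rewrite ler_wpM2r // hdot_ge0.
Qed.

End SelfAdjoint.

(** * Counting edges and forests *)

Lemma card_edge_set (V : finType) (e : rel V) :
  symmetric e -> irreflexive e ->
  #|[set p : V * V | e p.1 p.2]| = (2 * #|edge_set e|)%N.
Proof.
move=> e_sym e_irr.
rewrite -sum1_card (partition_big_imset (fun p : V * V => [set p.1; p.2])) /=.
have -> : [set [set p.1; p.2] | p in [set p : V * V | e p.1 p.2]] = edge_set e.
  by apply/setP => A; apply/imsetP/imsetP => -[p]; rewrite inE => pP ->;
    exists p; rewrite // inE.
rewrite mulnC -sum_nat_const; apply: eq_bigr => A /imsetP[[x y]].
rewrite inE /= => exy ->.
have xy : x != y by apply: contraTneq exy => ->; rewrite e_irr.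
have <- : #|[set (x, y); (y, x)]| = 2%N.
  by rewrite cards2 xpair_eqE negb_and xy.
rewrite sum1dep_card.
apply: eq_card => -[u v]; rewrite !inE /= !xpair_eqE.
apply/andP/orP => [[euv /eqP uvE]|].
  have := set21 u v; have := set22 u v; rewrite uvE !inE => v_in u_in.
  move: u_in v_in euv => /orP[] /eqP-> /orP[] /eqP->;
    rewrite ?e_irr ?eqxx //= => _; by [left|right].
case=> /andP[/eqP-> /eqP->]; first by rewrite exy eqxx.
by rewrite e_sym exy finset.setUC eqxx.
Qed.

Lemma sum_degree (V : finType) (e : rel V) :
  symmetric e -> irreflexive e ->
  (\sum_x degree e x = 2 * #|edge_set e|)%N.
Proof.
move=> e_sym e_irr; rewrite -card_edge_set // -sum1dep_card.
rewrite -(pair_big_dep xpredT e (fun _ _ => 1%N)) /=.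
by apply: eq_bigr => x _; rewrite sum1dep_card.
Qed.

(** A breadth-first spanning forest, given by the parent of each vertex other
    than the roots: [depth] is the distance to the root of the component, and
    the parent is the next vertex on a shortest path to it. *)
Lemma spanning_forest (V : finType) (e : rel V) : symmetric e ->
  exists (par : V -> V) (depth : V -> nat), forall x, x \notin roots e ->
    e x (par x) /\ (depth (par x) < depth x)%N.
Proof.
move=> e_sym; have csym := sym_connect_sym e_sym.
pose reach x n :=
  [exists p : n.-tuple V, path e x p && (last x p == fingraph.root e x)].
have reachP x n : reflect
    (exists2 p, path e x p & last x p = fingraph.root e x /\ size p = n)
    (reach x n).
  apply: (iffP existsP) => [[p /andP[xp /eqP lp]]|[p xp [lp sp]]].
    by exists p => //; rewrite size_tuple.
  have spP : size p == n by apply/eqP.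
  by exists (Tuple spP); rewrite xp lp eqxx.
have reach_ex x : exists n, reach x n.
  have /connectP[p xp lp] := connect_root e x.
  by exists (size p); apply/reachP; exists p.
pose depth x := ex_minn (reach_ex x).
have closer x : x \notin roots e -> exists y, e x y && (depth y < depth x)%N.
  move=> x_nroot; rewrite {2}/depth; case: ex_minnP => n /reachP[[|y p]].
    by move=> _ [/= lp _]; case/negP: x_nroot; apply/eqP.
  move=> /= /andP[exy yp] [lp <-] _; exists y; rewrite exy ltnS /depth.
  case: ex_minnP => m _; apply; apply/reachP; exists p => //; split=> //.
  by rewrite lp; apply/fingraph.rootP; [|exact: connect1].
exists (fun x => odflt x [pick y | e x y && (depth y < depth x)%N]), depth.
move=> x /closer x_ex; case: pickP => [y /andP[]//|none].
by case: x_ex => y; rewrite none.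
Qed.

(** The pairs [(x, par x)] and [(par x, x)] are pairwise distinct: the depth
    decreases along the former and increases along the latter. *)
Lemma card_forest_pairs (V : finType) (e q : rel V) (par : V -> V)
    (depth : V -> nat) :
  symmetric q ->
  (forall x, x \notin roots e ->
    q x (par x) /\ (depth (par x) < depth x)%N) ->
  (2 * (#|V| - n_comp e V) <= #|[set p : V * V | q p.1 p.2]|)%N.
Proof.
move=> q_sym forest.
pose up := [set (x, par x) | x in [predC roots e]].
pose down := [set (par x, x) | x in [predC roots e]].
have card_nroot : #|[predC roots e]| = (#|V| - n_comp e V)%N.
  rewrite -(cardC (roots e)) /n_comp_mem.
  have -> : #|predI (roots e) V| = #|roots e|.
    by apply: eq_card => x; rewrite !inE andbT.
  by rewrite addKn.
have card_up : #|up| = (#|V| - n_comp e V)%N.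
  by rewrite card_imset // => x y [].
have card_down : #|down| = (#|V| - n_comp e V)%N.
  by rewrite card_imset // => x y [].
have disj : up :&: down = finset.set0.
  apply/setP => -[u v]; rewrite !inE; apply/negP => /andP[].
  move=> /imsetP[x x_nroot [-> ->]] /imsetP[y y_nroot [xE yE]].
  have [_] := forest _ x_nroot; have [_] := forest _ y_nroot.
  by rewrite -xE yE => lt1 lt2; have := ltn_trans lt1 lt2; rewrite ltnn.
rewrite mul2n -addnn -{1}card_up -card_down -cardsUI disj cards0 addn0.
apply/subset_leq_card/fintype.subsetP => _ /setUP[] /imsetP[x x_nroot ->];
  rewrite inE /=.
  by have [] := forest _ x_nroot.
by rewrite q_sym; have [] := forest _ x_nroot.
Qed.

(** Parallel transport from the roots: the value at a vertex is determined by
    the value at its parent, so the function is built by induction on depth. *)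
Lemma forest_gauge (C : numDomainType) (V : finType) (A : pred V)
    (par : V -> V) (depth : V -> nat) (s : V -> V -> C) :
  (forall x, A x -> `|s x (par x)| = 1 /\ (depth (par x) < depth x)%N) ->
  exists g : V -> C, (forall x, `|g x| = 1) /\
    forall x, A x -> g x = s x (par x) * g (par x).
Proof.
move=> s1.
have [n dn] : exists n, forall x, (depth x <= n)%N.
  by exists (\max_x depth x)%N => x; apply: leq_bigmax.
suff [g [g1 gP]] : exists g : V -> C, (forall x, `|g x| = 1) /\
    forall x, A x -> (depth x <= n)%N -> g x = s x (par x) * g (par x).
  by exists g; split=> // x Ax; apply: gP.
elim: n {dn} => [|n [g [g1 gP]]].
  exists (fun=> 1); split=> [x|x /s1[_ d_lt]]; first by rewrite normr1.
  by rewrite leqNgt (leq_ltn_trans _ d_lt).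
exists (fun x =>
  if A x && (n < depth x)%N then s x (par x) * g (par x) else g x).
split=> [x|x Ax dx].
  by case: ifP => // /andP[/s1[s1x _] _]; rewrite normrM s1x g1 mul1r.
have [_ d_lt] := s1 x Ax.
have -> : (n < depth (par x))%N = false.
  by apply/negbTE; rewrite -leqNgt -ltnS (leq_trans d_lt).
by rewrite andbF Ax /=; case: ltnP => // ?; apply: gP.
Qed.

(** * Test functions for the magnetic Laplacian *)

Section Magnetic.
Variables (R : realType) (V : finType) (e : rel V) (s : V -> V -> R[i]).
Hypotheses (e_sym : symmetric e) (e_irr : irreflexive e).
Hypothesis s_pot : magnetic_potential e s.

Lemma potentialC x y : e x y -> s y x = (s x y)^*.
Proof.
move=> exy; have [s1 ->] := s_pot exy.
by rewrite invC_norm s1 expr1n invr1 mul1r.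
Qed.

Lemma potentialK x y : e x y -> s y x * s x y = 1.
Proof.
move=> exy; have [s1 ->] := s_pot exy.
by rewrite mulVf // -normr_eq0 s1 oner_eq0.
Qed.

Lemma magnetic_laplacianE f x :
  magnetic_laplacian e s f x =
    (degree e x)%:R * f x - \sum_(y | e x y) s x y * f y.
Proof.
have -> : degree e x = #|e x| by apply: eq_card => y; rewrite inE.
by rewrite ffunE sumrB sumr_const mulr_natl.
Qed.

(** The diagonal part is real, and exchanging the ends of the edges conjugates
    the potential in the other part. *)
Lemma magnetic_laplacian_selfadjoint f g :
  hdot (magnetic_laplacian e s f) g = hdot f (magnetic_laplacian e s g).
Proof.
rewrite /hdot.
under eq_bigr => x do rewrite ffunE sumrB mulrBl !mulr_suml.
under [RHS]eq_bigr => x do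
  rewrite ffunE sumrB rmorphB mulrBr !rmorph_sum !mulr_sumr.
rewrite !sumrB; congr (_ - _).
rewrite (exchange_big_dep xpredT) //=; apply: eq_bigr => x _.
under eq_bigl do rewrite e_sym.
apply: eq_bigr => y exy.
by rewrite rmorphM /= potentialC // mulrAC mulrC.
Qed.

Lemma lambda1_rayleigh f : (0 < #|V|)%N ->
  (lambda1 e s)%:C * hdot f f <= hdot (magnetic_laplacian e s f) f.
Proof.
move=> V_gt0.
exact: (smallest_eigenvalue_rayleigh V_gt0 magnetic_laplacian_selfadjoint).
Qed.

Let sum_point x y :
  \sum_(z | e x z) s x z * point_mass R y z = s x y *+ e x y.
Proof.
rewrite big_mkcond (bigD1 y) //= big1 ?addr0 => [|z /negPf zy]; last first.
  by rewrite ffunE zy mulr0 if_same.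
by rewrite ffunE eqxx mulr1; case: (e x y).
Qed.

Lemma lambda1_le_degree x : lambda1 e s <= (degree e x)%:R.
Proof.
have V_gt0 : (0 < #|V|)%N by apply/card_gt0P; exists x.
have := lambda1_rayleigh (point_mass R x) V_gt0.
rewrite !hdot_point magnetic_laplacianE sum_point e_irr ffunE eqxx.
by rewrite !mulr1 subr0 -(rmorph_nat (real_complex R)) lecR.
Qed.

(** The test function takes the values [1] at [x] and [s y x] at [y]. *)
Lemma lambda1_le_edge x y : e x y ->
  2 * lambda1 e s <= (degree e x)%:R + (degree e y)%:R - 2.
Proof.
move=> exy; have V_gt0 : (0 < #|V|)%N by apply/card_gt0P; exists x.
have yx : (y == x) = false.
  by apply/negbTE; apply: contraTneq exy => ->; rewrite e_irr.
pose c := s y x; pose f := point_mass R x + c *: point_mass R y.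
have hdot_f g : hdot g f = g x + c^* * g y.
  rewrite -!hdot_point /hdot mulr_sumr -big_split /=.
  apply: eq_bigr => z _; rewrite !ffunE rmorphD rmorphM mulrDr /=.
  by rewrite [_ * (_ * _)]mulrCA.
have cE : c^* = s x y by rewrite -potentialC // e_sym.
have sK : s x y * c = 1 by rewrite potentialK // e_sym.
have fx : f x = 1 by rewrite !ffunE eqxx eq_sym yx scaler0 addr0.
have fy : f y = c by rewrite !ffunE eqxx yx add0r [_ *: _]mulr1.
have sum_f z :
    \sum_(w | e z w) s z w * f w = s z x *+ e z x + c * (s z y *+ e z y).
  rewrite -!sum_point mulr_sumr -big_split /=; apply: eq_bigr => w _.
  have -> : f w = point_mass R x w + c * point_mass R y w by rewrite !ffunE.
  by rewrite mulrDr [s z w * (c * _)]mulrCA.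
have := lambda1_rayleigh f V_gt0.
rewrite !hdot_f !magnetic_laplacianE !sum_f fx fy cE !e_irr exy e_sym exy.
rewrite !mulr0 !mulr1n; have -> : 1 + s x y * c = 2%:R by rewrite sK.
rewrite add0r addr0 mulr1 [c * _]mulrC sK -/c mulrBr mulrCA sK mulr1.
rewrite -!(rmorph_nat (real_complex R)) -(rmorph1 (real_complex R)).
rewrite -!rmorphB -rmorphM -rmorphD lecR mulrC => /le_trans; apply.
by rewrite addrACA -opprD.
Qed.

(** The oriented edges along which [g] is not parallel. *)
Definition frustrated (g : V -> R[i]) : {set V * V} :=
  [set p | e p.1 p.2 && (g p.1 != s p.1 p.2 * g p.2)].

Lemma lambda1_le_frustrated (g : V -> R[i]) : (0 < #|V|)%N ->
  (forall x, `|g x| = 1) ->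
  lambda1 e s * #|V|%:R <= 2 * #|frustrated g|%:R.
Proof.
move=> V_gt0 g1; pose f : {ffun V -> R[i]^o} := finfun g.
have := lambda1_rayleigh f V_gt0.
have -> : hdot f f = #|V|%:R.
  rewrite hdotE -sum1_card natr_sum; apply: eq_bigr => x _.
  by rewrite ffunE g1 expr1n.
move=> ray.
have : hdot (magnetic_laplacian e s f) f <= 2 * #|frustrated g|%:R.
  (* Real because comparable with a real number, hence at most its modulus;
     the triangle inequality then applies edge by edge. *)
  have hreal : hdot (magnetic_laplacian e s f) f \is Num.real.
    rewrite -(ler_real ray) -(rmorph_nat (real_complex R)) -rmorphM.
    by apply/complex_realP; eexists.
  apply: le_trans (real_ler_norm hreal) _.
  apply: le_trans (ler_norm_sum _ _ _) _.
  rewrite /frustrated -sum1dep_card natr_sum mulr_sumr.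
  rewrite -(pair_big_dep xpredT (fun x y => e x y && (g x != s x y * g y))
    (fun _ _ => 2 * 1)) /=.
  apply: ler_sum => x _; rewrite normrM norm_conjC [f x]ffunE g1 !mulr1.
  have -> : magnetic_laplacian e s f x =
      (\sum_(y | e x y) (g x - s x y * g y) : R[i]).
    by rewrite ffunE; apply: eq_bigr => y _; rewrite !ffunE.
  apply: le_trans (ler_norm_sum _ _ _) _.
  rewrite big_mkcondr /=; apply: ler_sum => y exy.
  case: eqP => [->|_] /=; first by rewrite subrr normr0.
  apply: le_trans (ler_normB _ _) _; rewrite normrM !g1.
  by have [-> _] := s_pot exy; rewrite !mulr1.
move=> /(le_trans ray).
by rewrite -natrM -!(rmorph_nat (real_complex R)) -rmorphM lecR natrM.
Qed.

(** Transport along a spanning forest leaves out at most [betti1 e] edges, each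
    of which has two orientations. *)
Lemma few_frustrated : exists g : V -> R[i], (forall x, `|g x| = 1) /\
  (#|frustrated g|%:Z <= 2 * betti1 e)%R.
Proof.
have [par [depth forest]] := spanning_forest e_sym.
have [x|g [g1 gP]] := @forest_gauge R[i] V (predC (roots e)) par depth s.
  by move=> /forest[ex d_lt]; have [s1 _] := s_pot ex.
exists g; split=> //; pose q x y := e x y && (g x == s x y * g y).
have q_sym : symmetric q.
  suff q_sub x y : q x y -> q y x by move=> x y; apply/idP/idP; apply: q_sub.
  case/andP=> exy /eqP gx; rewrite /q e_sym exy gx mulrA potentialK //.
  by rewrite mul1r eqxx.
have : forall x, x \notin roots e -> q x (par x) /\ (depth (par x) < depth x)%N.
  by move=> x xr; have [ex d_lt] := forest x xr; rewrite /q ex (gP x xr) eqxx.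
move=> /(card_forest_pairs q_sym); set Q := #|_| => Q_ge.
have QB : (Q + #|frustrated g| = 2 * #|edge_set e|)%N.
  rewrite -card_edge_set // -(cardsID [set p : V * V | q p.1 p.2]).
  congr (_ + _)%N; apply: eq_card => p; rewrite !inE /q.
    by rewrite andbA andbb.
  by case: (e _ _); rewrite ?andbT.
have ncV : (n_comp e V <= #|V|)%N.
  by apply: subset_leq_card; apply/fintype.subsetP.
by move: Q_ge QB ncV; rewrite /betti1; lia.
Qed.

Lemma lambda1_le_betti1 : (0 < #|V|)%N ->
  lambda1 e s * #|V|%:R <= 4 * (betti1 e)%:~R.
Proof.
move=> V_gt0; have [g [g1]] := few_frustrated.
rewrite -(ler_int R) rmorphM /= => frust_le.
apply: le_trans (lambda1_le_frustrated V_gt0 g1) _.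
have -> : 4 = 2 * 2 :> R by rewrite -natrM.
by rewrite -mulrA ler_pM2l.
Qed.

End Magnetic.

Theorem proposition3p1 (R : realType) (V : finType) (e : rel V)
    (e_sym : symmetric e) (e_irr : irreflexive e)
    (e_edge : exists x y : V, e x y) :
  magneto_spectral_height R e <=
    Num.min (2 * #|edge_set e|%:R / #|V|%:R)
      (Num.min (4 * (betti1 e)%:~R / #|V|%:R)
               ((max_degree e)%:R - 1)).
Proof.
have [x [y exy]] := e_edge.
have V_gt0 : (0 < #|V|)%N by apply/card_gt0P; exists x.
apply: ge_sup => [|_ [s s_pot <-]].
  exists (lambda1 e (fun _ _ => 1 : R[i])), (fun _ _ => 1) => // u v _.
  by rewrite normr1 invr1.
rewrite !le_min !ler_pdivlMr ?ltr0n // lambda1_le_betti1 //=.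
apply/andP; split.
  rewrite -natrM -sum_degree // natr_sum mulr_natr -sumr_const.
  by apply: ler_sum => z _; apply: lambda1_le_degree.
rewrite -(@ler_pM2l _ 2) //; apply: le_trans (lambda1_le_edge _ _ _ exy) _ => //.
rewrite mulrBr mulr1 lerB // mulr_natl mulr2n lerD // ler_nat;
  exact: (leq_bigmax (F := degree e)).
Qed.
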